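(* Let $R=k[[t,x_1,\dots,x_m]]$ be the formal power series ring over a field $k$ of characteristic $0$ in $m+1$ indeterminates, and let $S=k[[t^2,x_1,\dots,x_m]]\subseteq R$. Let $f_1(t),\dots,f_m(t)\in k[[t]]$. Put $$Q_1=(x_1-f_1(t),\dots,x_m-f_m(t))R,\qquad Q_2=(x_1-f_1(-t),\dots,x_m-f_m(-t))R.$$ Then $Q_1$ and $Q_2$ are prime ideals that are conjugate under the action of the automorphism $\sigma:R\to R$ given by $\sigma(t)=-t$ and $\sigma(x_i)=x_i$ for $1\le i\le m$. Further, $Q_1$ and $Q_2$ contract to the same prime ideal $P$ of $S$, i.e. $P=Q_1\cap S=Q_2\cap S=(Q_1\cap Q_2)\cap S$. Let $\mathfrak m=(t^2,x_1,\dots,x_m)S$. Then $P^{(2)}\subseteq \mathfrak m P$.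
   Context: For an ideal $I$ of a ring $A$ and a positive integer $n$, the $n$th symbolic power is $I^{(n)}=\{a\in A: \tfrac{a}{1}\in I^nA_{\mathfrak p}\text{ for every associated prime }\mathfrak p\text{ of }I\}$; for a prime ideal $P$ this is $\{a\in A:\tfrac{a}{1}\in P^nA_P\}$.
   Formalization: Each f_i(t) is assumed to have zero constant term; if some f_i(0) ≠ 0 (e.g. m=1, f_1=1), then x_i − f_i(t) is a unit of R, so Q_1 = R is not prime and the claim fails. *)

(* Defs.v *)
From HB Require Import structures.
From mathcomp Require Import all_boot all_order all_algebra.
From mathcomp Require Import generic_quotient ring_quotient ring.
From mathcomp Require Import boolp classical_sets.
From mathcomp Require Import mpoly.

Set Implicit Arguments.
Unset Strict Implicit.
Unset Printing Implicit Defensive.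

Import GRing.Theory.

Local Open Scope ring_scope.
Local Open Scope quotient_scope.
Local Open Scope classical_set_scope.

Section Ideals.
Variable A : comNzRingType.
Implicit Types (B I J P : set A) (n : nat).

Definition ideal_gen B : set A :=
  [set a | exists n (c b : 'I_n -> A),
     (forall i, B (b i)) /\ a = \sum_(i < n) c i * b i].

Definition ideal_mul I J : set A := ideal_gen [set a * b | a in I & b in J].

Definition ideal_pow I n : set A :=
  ideal_gen [set \prod_(i < n) a i | a in [set a : 'I_n -> A | forall i, I (a i)]].

(* [idealr_closed] includes properness *)
Definition prime_ideal P : Prop :=
  idealr_closed (fun a => a \in P) /\ prime_idealr_closed (fun a => a \in P).

Definition assoc_prime I (p : prime_idealr A) : Prop :=
  exists x, forall a, (a \in p) <-> I (a * x).

End Ideals.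

(* Localization of A at a prime ideal p: the quotient of the pairs (a, s) with
   s outside p by  (a, s) ~ (b, t)  iff  u (a t - b s) = 0 for some u outside
   p. *)

Section Localization.
Variables (A : comNzRingType) (p : prime_idealr A).

Record loc_pair := LocPair {
  loc_num : A;
  loc_den : A;
  _ : loc_den \notin p
}.

HB.instance Definition _ := gen_eqMixin loc_pair.
HB.instance Definition _ := gen_choiceMixin loc_pair.

Lemma loc_denP (x : loc_pair) : loc_den x \notin p.
Proof. by case: x. Qed.

Lemma loc_one_notin : 1 \notin p.
Proof. by rewrite (idealr1 p). Qed.

Lemma loc_mul_notin (s t : A) : s \notin p -> t \notin p -> s * t \notin p.
Proof. by move=> sp tp; rewrite prime_idealrM negb_or sp tp. Qed.

Definition loc_equiv (x y : loc_pair) : bool :=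
  `[< exists2 u, u \notin p &
      u * (loc_num x * loc_den y - loc_num y * loc_den x) = 0 >].

Lemma loc_equiv_refl : reflexive loc_equiv.
Proof.
by move=> x; apply/asboolP; exists 1; rewrite ?loc_one_notin // subrr mulr0.
Qed.

Lemma loc_equiv_sym : ssrbool.symmetric loc_equiv.
Proof.
by move=> x y; apply/asboolP/asboolP=> -[u up e]; exists u => //;
  rewrite -opprB mulrN e oppr0.
Qed.

Lemma loc_equiv_trans : transitive loc_equiv.
Proof.
move=> y x z /asboolP[u up e1] /asboolP[v vp e2]; apply/asboolP.
exists (u * v * loc_den y); first by rewrite !loc_mul_notin ?loc_denP.
have -> : u * v * loc_den y * (loc_num x * loc_den z - loc_num z * loc_den x) =
  v * loc_den z * (u * (loc_num x * loc_den y - loc_num y * loc_den x)) +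
  u * loc_den x * (v * (loc_num y * loc_den z - loc_num z * loc_den y)).
  by ring.
by rewrite e1 e2 !mulr0 addr0.
Qed.

Canonical loc_equiv_equiv :=
  EquivRel loc_equiv loc_equiv_refl loc_equiv_sym loc_equiv_trans.

Definition loc := {eq_quot loc_equiv}.

HB.instance Definition _ : EqQuotient _ loc_equiv loc := EqQuotient.on loc.
HB.instance Definition _ := Choice.on loc.

Definition loc_frac (a s : A) (sp : s \notin p) : loc :=
  \pi_loc (LocPair a sp).

Lemma loc_frac_eq (a b s t : A) (sp : s \notin p) (tp : t \notin p) :
  loc_frac a sp = loc_frac b tp <->
  exists2 u, u \notin p & u * (a * t - b * s) = 0.
Proof.
split=> [/eqmodP/asboolP //|h]; by apply/eqmodP/asboolP.
Qed.

Lemma loc_fracP (x : loc) : exists a s (sp : s \notin p), x = loc_frac a sp.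
Proof.
rewrite -[x]reprK; case: (repr x) => a s sp; by exists a, s, sp.
Qed.

Definition loc_addf (x y : loc_pair) : loc_pair :=
  LocPair (loc_num x * loc_den y + loc_num y * loc_den x)
          (loc_mul_notin (loc_denP x) (loc_denP y)).
Definition loc_oppf (x : loc_pair) : loc_pair :=
  LocPair (- loc_num x) (loc_denP x).
Definition loc_mulf (x y : loc_pair) : loc_pair :=
  LocPair (loc_num x * loc_num y) (loc_mul_notin (loc_denP x) (loc_denP y)).

Definition loc_add (x y : loc) : loc := \pi_loc (loc_addf (repr x) (repr y)).
Definition loc_opp (x : loc) : loc := \pi_loc (loc_oppf (repr x)).
Definition loc_mul (x y : loc) : loc := \pi_loc (loc_mulf (repr x) (repr y)).


Lemma loc_frac_repr (a s : A) (sp : s \notin p) :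
  let x := repr (loc_frac a sp) in
  exists2 u, u \notin p & u * (loc_num x * s - a * loc_den x) = 0.
Proof.
move=> x; apply/asboolP; rewrite -[`[< _ >]]/(loc_equiv x (LocPair a sp)).
by apply/eqmodP; rewrite reprK.
Qed.

Lemma loc_addE (a b s t : A) (sp : s \notin p) (tp : t \notin p) :
  loc_add (loc_frac a sp) (loc_frac b tp) =
  loc_frac (a * t + b * s) (loc_mul_notin sp tp).
Proof.
have [u up e1] := loc_frac_repr a sp; have [v vp e2] := loc_frac_repr b tp.
apply/loc_frac_eq; exists (u * v); rewrite ?loc_mul_notin //=.
set x := repr (loc_frac a sp) in e1 *; set y := repr (loc_frac b tp) in e2 *.
transitivity (v * t * loc_den y * (u * (loc_num x * s - a * loc_den x)) +
  u * s * loc_den x * (v * (loc_num y * t - b * loc_den y))); first by ring.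
by rewrite e1 e2 !mulr0 addr0.
Qed.

Lemma loc_mulE (a b s t : A) (sp : s \notin p) (tp : t \notin p) :
  loc_mul (loc_frac a sp) (loc_frac b tp) =
  loc_frac (a * b) (loc_mul_notin sp tp).
Proof.
have [u up e1] := loc_frac_repr a sp; have [v vp e2] := loc_frac_repr b tp.
apply/loc_frac_eq; exists (u * v); rewrite ?loc_mul_notin //=.
set x := repr (loc_frac a sp) in e1 *; set y := repr (loc_frac b tp) in e2 *.
transitivity (v * t * loc_num y * (u * (loc_num x * s - a * loc_den x)) +
  u * a * loc_den x * (v * (loc_num y * t - b * loc_den y))); first by ring.
by rewrite e1 e2 !mulr0 addr0.
Qed.

Lemma loc_oppE (a s : A) (sp : s \notin p) :
  loc_opp (loc_frac a sp) = loc_frac (- a) sp.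
Proof.
have [u up e1] := loc_frac_repr a sp.
apply/loc_frac_eq; exists u => //=.
set x := repr (loc_frac a sp) in e1 *.
transitivity (- (u * (loc_num x * s - a * loc_den x))); first by ring.
by rewrite e1 oppr0.
Qed.

Definition loc_of (a : A) : loc := loc_frac a loc_one_notin.

Let loc_frac_eq1 (a b s t : A) (sp : s \notin p) (tp : t \notin p) :
  a * t = b * s -> loc_frac a sp = loc_frac b tp.
Proof.
move=> e; apply/loc_frac_eq; exists 1; first exact: loc_one_notin.
by rewrite e subrr mulr0.
Qed.

Let loc_addA : associative loc_add.
Proof.
move=> x y z.
have [a [s [sp ->]]] := loc_fracP x; have [b [t [tp ->]]] := loc_fracP y.
have [c [r [rp ->]]] := loc_fracP z; rewrite !loc_addE.
by apply: loc_frac_eq1; ring.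
Qed.

Let loc_addC : commutative loc_add.
Proof.
move=> x y.
have [a [s [sp ->]]] := loc_fracP x; have [b [t [tp ->]]] := loc_fracP y.
by rewrite !loc_addE; apply: loc_frac_eq1; ring.
Qed.

Let loc_add0 : left_id (loc_of 0) loc_add.
Proof.
move=> x; have [a [s [sp ->]]] := loc_fracP x.
by rewrite loc_addE; apply: loc_frac_eq1; ring.
Qed.

Let loc_addN : left_inverse (loc_of 0) loc_opp loc_add.
Proof.
move=> x; have [a [s [sp ->]]] := loc_fracP x.
by rewrite loc_oppE loc_addE; apply: loc_frac_eq1; ring.
Qed.

HB.instance Definition _ :=
  GRing.isZmodule.Build loc loc_addA loc_addC loc_add0 loc_addN.

Let loc_mulA : associative loc_mul.
Proof.
move=> x y z.
have [a [s [sp ->]]] := loc_fracP x; have [b [t [tp ->]]] := loc_fracP y.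
have [c [r [rp ->]]] := loc_fracP z; rewrite !loc_mulE.
by apply: loc_frac_eq1; ring.
Qed.

Let loc_mulC : commutative loc_mul.
Proof.
move=> x y.
have [a [s [sp ->]]] := loc_fracP x; have [b [t [tp ->]]] := loc_fracP y.
by rewrite !loc_mulE; apply: loc_frac_eq1; ring.
Qed.

Let loc_mul1 : left_id (loc_of 1) loc_mul.
Proof.
move=> x; have [a [s [sp ->]]] := loc_fracP x.
by rewrite loc_mulE; apply: loc_frac_eq1; ring.
Qed.

Let loc_mulD : left_distributive loc_mul loc_add.
Proof.
move=> x y z.
have [a [s [sp ->]]] := loc_fracP x; have [b [t [tp ->]]] := loc_fracP y.
have [c [r [rp ->]]] := loc_fracP z; rewrite !(loc_mulE, loc_addE).
by apply: loc_frac_eq1; ring.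
Qed.

Let loc_1neq0 : loc_of 1 != loc_of 0.
Proof.
apply/eqP => /loc_frac_eq[u up]; rewrite mulr1 mul0r subr0 mulr1 => u0.
by move: up; rewrite u0 idealr0.
Qed.

HB.instance Definition _ := GRing.Zmodule_isComNzRing.Build loc
  loc_mulA loc_mulC loc_mul1 loc_mulD loc_1neq0.

Let loc_of_additive : zmod_morphism loc_of.
Proof.
move=> a b; rewrite -[RHS]/(loc_add (loc_of a) (loc_opp (loc_of b))).
by rewrite loc_oppE loc_addE; apply: loc_frac_eq1; ring.
Qed.

Let loc_of_multiplicative : monoid_morphism loc_of.
Proof.
split=> // a b; rewrite -[RHS]/(loc_mul (loc_of a) (loc_of b)).
by rewrite loc_mulE; apply: loc_frac_eq1; ring.
Qed.

HB.instance Definition _ :=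
  GRing.isZmodMorphism.Build A loc loc_of loc_of_additive.
HB.instance Definition _ :=
  GRing.isMonoidMorphism.Build A loc loc_of loc_of_multiplicative.

End Localization.

Definition symbolic_power (A : comNzRingType) (I : set A) (n : nat) : set A :=
  [set a | forall p : prime_idealr A, assoc_prime I p ->
     ideal_gen [set loc_of p b | b in ideal_pow I n] (loc_of p a)].

(* Formal power series over K in variables indexed by 'I_n, encoded by their
   coefficients; 'X_{1..n} is the type of exponent vectors. *)

Record mseries (n : nat) (K : Type) :=
  MSeries { mscoef :> 'X_{1..n} -> K }.

Section MSeries.
Variable n : nat.

Section Choice.
Variable K : Type.
HB.instance Definition _ := gen_eqMixin (mseries n K).
HB.instance Definition _ := gen_choiceMixin (mseries n K).
Lemma mseriesP (F G : mseries n K) : (forall u, F u = G u) <-> F = G.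
Proof.
split=> [|-> //]; case: F G => F [G] /= FG; congr MSeries; exact/funext.
Qed.
End Choice.

Variable K : comNzRingType.
Implicit Types (F G H : mseries n K) (u : 'X_{1..n}) (i : 'I_n).

Definition mszero : mseries n K := MSeries (fun=> 0).
Definition msone : mseries n K := MSeries (fun u => (u == 0%MM)%:R).
Definition msopp F : mseries n K := MSeries (fun u => - F u).
Definition msadd F G : mseries n K := MSeries (fun u => F u + G u).
(* The ranges of v and w are only bounded to make the Cauchy sum finite. *)
Definition msmul F G : mseries n K := MSeries (fun u =>
  \sum_(vw : 'X_{1..n < (mdeg u).+1, (mdeg u).+1} | u == (vw.1 + vw.2)%MM)
    F vw.1 * G vw.2).
Definition msX i : mseries n K := MSeries (fun u => (u == U_(i)%MM)%:R).

Let msaddA : associative msadd.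
Proof. by move=> F G H; apply/mseriesP => u /=; rewrite addrA. Qed.
Let msaddC : commutative msadd.
Proof. by move=> F G; apply/mseriesP => u /=; rewrite addrC. Qed.
Let msadd0 : left_id mszero msadd.
Proof. by move=> F; apply/mseriesP => u /=; rewrite add0r. Qed.
Let msaddN : left_inverse mszero msopp msadd.
Proof. by move=> F; apply/mseriesP => u /=; rewrite addNr. Qed.

HB.instance Definition _ :=
  GRing.isZmodule.Build (mseries n K) msaddA msaddC msadd0 msaddN.

Definition mstrunc (b : nat) F : {mpoly K[n]} :=
  \sum_(u : 'X_{1..n < b}) F u *: 'X_[u].

Lemma mstruncE b F u : (mdeg u < b)%N -> (mstrunc b F)@_u = F u.
Proof. exact: mcoeff_mpoly. Qed.

Lemma msmul_mpoly F G u (p q : {mpoly K[n]}) :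
  (forall v, (mdeg v <= mdeg u)%N -> p@_v = F v) ->
  (forall v, (mdeg v <= mdeg u)%N -> q@_v = G v) ->
  msmul F G u = (p * q)@_u.
Proof.
move=> pF qG; rewrite mcoeffM /=; apply: eq_bigr => vw _.
by rewrite pF ?qG // -ltnS bmdeg.
Qed.

Lemma msmul_trunc b F G u : (mdeg u < b)%N ->
  msmul F G u = (mstrunc b F * mstrunc b G)@_u.
Proof.
by move=> ub; apply: msmul_mpoly => v vu; rewrite mstruncE // (leq_ltn_trans vu).
Qed.

Let msmulA : associative msmul.
Proof.
move=> F G H; apply/mseriesP => u; pose b := (mdeg u).+1.
pose T := mstrunc b.
have TE E v : (mdeg v <= mdeg u)%N -> (T E)@_v = E v.
  by move=> vu; rewrite mstruncE.
have TM E E' v : (mdeg v <= mdeg u)%N -> (T E * T E')@_v = msmul E E' v.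
  by move=> vu; rewrite -msmul_trunc.
by rewrite (msmul_mpoly (TE F) (TM G H)) (msmul_mpoly (TM F G) (TE H)) mulrA.
Qed.

Let msmulC : commutative msmul.
Proof.
move=> F G; apply/mseriesP => u.
by rewrite !(@msmul_trunc (mdeg u).+1) // mulrC.
Qed.

Let msmul1 : left_id msone msmul.
Proof.
move=> F; apply/mseriesP => u.
have T1 v : (mdeg v <= mdeg u)%N -> (1 : {mpoly K[n]})@_v = msone v.
  by rewrite mcoeff1 -[msone v]/((v == 0%MM)%:R).
have TF v : (mdeg v <= mdeg u)%N -> (mstrunc (mdeg u).+1 F)@_v = F v.
  by move=> vu; rewrite mstruncE.
by rewrite (msmul_mpoly T1 TF) mul1r mstruncE.
Qed.

Let msmulD : left_distributive msmul msadd.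
Proof.
move=> F G H; apply/mseriesP => u /=; rewrite -big_split /=.
by apply: eq_bigr => vw _; rewrite mulrDl.
Qed.

Let ms1neq0 : msone != mszero.
Proof.
by apply/eqP => /mseriesP/(_ 0%MM)/=/eqP; rewrite eqxx oner_eq0.
Qed.

HB.instance Definition _ := GRing.Zmodule_isComNzRing.Build (mseries n K)
  msmulA msmulC msmul1 msmulD ms1neq0.

Lemma mscoefM F G u : (F * G) u =
  \sum_(vw : 'X_{1..n < (mdeg u).+1, (mdeg u).+1} | u == (vw.1 + vw.2)%MM)
    F vw.1 * G vw.2.
Proof. by []. Qed.

(* F(c_0 X_0, ..., c_(n-1) X_(n-1)) *)
Definition msscale (c : 'I_n -> K) F : mseries n K :=
  MSeries (fun u => (\prod_(i < n) c i ^+ u i) * F u).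

Let msscale_additive c : zmod_morphism (msscale c).
Proof. by move=> F G; apply/mseriesP => u /=; rewrite mulrBr. Qed.

Let msscale_multiplicative c : monoid_morphism (msscale c).
Proof.
split=> [|F G]; apply/mseriesP => u /=.
  case: eqP => [->|]; rewrite ?mulr0 // mulr1.
  by apply: big1 => i _; rewrite mnm0E expr0.
rewrite big_distrr /=; apply: eq_bigr => vw /eqP e.
rewrite mulrACA -big_split /=; congr (_ * _).
by apply: eq_bigr => i _; rewrite [in LHS]e mnmDE exprD.
Qed.

HB.instance Definition _ c :=
  GRing.isZmodMorphism.Build _ _ (msscale c) (msscale_additive c).
HB.instance Definition _ c :=
  GRing.isMonoidMorphism.Build _ _ (msscale c) (msscale_multiplicative c).

Lemma msscaleX c i : msscale c (msX i) = MSeries (fun u => c i * msX i u).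
Proof.
apply/mseriesP => u /=; case: eqP => [->|_]; rewrite ?mulr0 // !mulr1.
rewrite (bigD1 i) //= mnm1E eqxx expr1 big1 ?mulr1 // => j ji.
by rewrite mnm1E eq_sym (negPf ji).
Qed.

End MSeries.

Arguments msX {n} K i.

(* In 'I_m.+1, the index ord0 stands for t and lift ord0 i for x_(i+1). *)

Section Main.
Variables (K : comNzRingType) (m : nat).
Local Notation R := (mseries m.+1 K).

Definition var_t : R := msX K ord0.
Definition var_x (i : 'I_m) : R := msX K (lift ord0 i).

(* k[[t]] -> k[[t, x_1, ..., x_m]] *)
Definition series_in_t (f : mseries 1 K) : R :=
  MSeries (fun u => if [forall i : 'I_m, u (lift ord0 i) == 0%N]
                    then f [multinom u ord0 | _ < 1] else 0).

(* f(-t) in k[[t]] *)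
Definition neg_arg (f : mseries 1 K) : mseries 1 K := msscale (fun=> -1) f.

Definition sigma : R -> R := msscale (fun i => if i == ord0 then -1 else 1).
HB.instance Definition _ := GRing.RMorphism.on sigma.

Lemma sigma_t : sigma var_t = - var_t.
Proof.
by rewrite /sigma msscaleX; apply/mseriesP => u /=; rewrite mulN1r.
Qed.

Lemma sigma_x i : sigma (var_x i) = var_x i.
Proof.
by rewrite /sigma msscaleX; apply/mseriesP => u /=; rewrite mul1r.
Qed.

Lemma sigmaK : involutive sigma.
Proof.
move=> F; apply/mseriesP => u /=; rewrite mulrA -big_split /=.
rewrite big1 ?mul1r // => i _.
by case: ifP => _; rewrite ?expr1n ?mulr1 // -expr2 sqrr_sign.
Qed.

Lemma series_in_tX : series_in_t (msX K ord0) = var_t.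
Proof.
apply/mseriesP => u /=; case: forallP => [u0|nu0].
  congr (_%:R); congr nat_of_bool; apply/eqP/eqP => /mnmP e; apply/mnmP => i.
    case: (unliftP ord0 i) => [j ->|->]; first by rewrite (eqP (u0 j)) mnm1E.
    by have := e ord0; rewrite mnmE !mnm1E.
  by rewrite mnmE (e ord0) !mnm1E !eqxx (ord1 i) eqxx.
case: eqP => // e; case: nu0 => i; by rewrite e mnm1E.
Qed.

(* S = k[[t^2, x_1, ..., x_m]]; see [even_tP] *)
Definition even_t : {pred R} :=
  fun F : R => `[< forall u : 'X_{1..m.+1}, odd (u ord0) -> F u = 0 >].

Let even_t_subring : subring_closed even_t.
Proof.
split=> [|F G /asboolP eF /asboolP eG|F G /asboolP eF /asboolP eG];
  apply/asboolP => u ou.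
- rewrite -[LHS]/((u == 0%MM)%:R); case: eqP ou => [->|//].
  by rewrite mnm0E.
- by rewrite -[LHS]/(F u - G u) eF // eG // subrr.
- rewrite mscoefM big1 // => vw /eqP/mnmP/(_ ord0) e; move: ou; rewrite e mnmDE oddD.
  case ov: (odd (vw.1 ord0)) => /= ow; first by rewrite eF ?mul0r.
  by rewrite [X in _ * X]eG ?mulr0.
Qed.

HB.instance Definition _ := GRing.isSubringClosed.Build R even_t even_t_subring.

Record even_series := EvenSeries {
  even_val :> R;
  _ : even_val \in even_t
}.

HB.instance Definition _ := [isSub for even_val].
HB.instance Definition _ := [Choice of even_series by <:].
HB.instance Definition _ := [SubChoice_isSubComNzRing of even_series by <:].

Lemma sqr_t_even : var_t ^+ 2 \in even_t.
Proof.
apply/asboolP => u ou; rewrite expr2 mscoefM big1 // => vw /eqP/mnmP/(_ ord0) e.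
rewrite /= ; case: eqP => [ev|]; rewrite ?mul0r // mul1r.
by case: eqP => // ew; move: ou; rewrite e ev ew mnmDE mnm1E.
Qed.

Lemma var_x_even i : var_x i \in even_t.
Proof.
apply/asboolP => u ou /=; case: eqP => // e.
by move: ou; rewrite e mnm1E.
Qed.

Definition even_t2 : even_series := EvenSeries sqr_t_even.
Definition even_x (i : 'I_m) : even_series := EvenSeries (var_x_even i).

(* G(t^2, x_1, ..., x_m) *)
Definition subst_sqr_t (G : R) : R :=
  MSeries (fun u => if odd (u ord0) then 0
     else G [multinom (if i == ord0 then (u i)./2 else u i) | i < m.+1]).

Lemma even_tP F : F \in even_t <-> exists G, F = subst_sqr_t G.
Proof.
split=> [/asboolP eF|[G ->]]; last by apply/asboolP => u /= ->.
exists (MSeries (fun u =>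
  F [multinom (if i == ord0 then (u i).*2 else u i) | i < m.+1])).
apply/mseriesP => u /=; case: ifP => [/eF //|ou]; congr (F _).
apply/mnmP => i; rewrite !mnmE; case: eqP => // ->.
by rewrite even_halfK ?ou.
Qed.

End Main.

(* Main.v *)
(* In k[[t]] write f_i = a_i + d_i with a_i even and d_i odd. If every d_i is 0,
   then P is generated by the z_i = x_i - a_i. Otherwise let o = d_(i0) be of
   least order: every d_i is c_i o with c_i even, and with w = x_(i0) - a_(i0)
   the prime P is generated by z_(i0) = w^2 - o^2 and z_i = x_i - a_i - c_i w
   for i <> i0. In both cases the Jacobian determinant of z_1, ..., z_m with
   respect to x_1, ..., x_m is nonzero modulo Q_1. Derivations map P^(2) into
   Q_1, so applying the d/dx_j to an element sum_i g_i z_i of P^(2) shows that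
   every g_i is in P, and P is contained in m. *)

Require Import Defs.
From HB Require Import structures.
From mathcomp Require Import all_boot all_order all_algebra.
From mathcomp Require Import generic_quotient ring_quotient ring.
From mathcomp Require Import boolp classical_sets.
From mathcomp Require Import mpoly.

Set Implicit Arguments.
Unset Strict Implicit.

Import GRing.Theory.

Local Open Scope ring_scope.
Local Open Scope classical_set_scope.

(** * Coefficients of power series; polynomials and constants as series *)

Section Coefficients.
Variables (n : nat) (K : comNzRingType).
Implicit Types (F G : mseries n K) (p q : {mpoly K[n]}) (u v : 'X_{1..n}).

Lemma mscoefD F G u : (F + G) u = F u + G u. Proof. by []. Qed.
Lemma mscoefN F u : (- F) u = - F u. Proof. by []. Qed.
Lemma mscoefB F G u : (F - G) u = F u - G u. Proof. by []. Qed.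
Lemma mscoef1 u : (1 : mseries n K) u = (u == 0%MM)%:R. Proof. by []. Qed.
Lemma mscoefX i u : msX K i u = (u == U_(i)%MM)%:R. Proof. by []. Qed.

Lemma mscoef_sum (I : Type) (r : seq I) (Q : pred I) (F : I -> mseries n K) u :
  (\sum_(i <- r | Q i) F i) u = \sum_(i <- r | Q i) F i u.
Proof. by elim/big_rec2: _ => // i y x _ <-. Qed.

Definition mspoly p : mseries n K := MSeries (fun u => p@_u).

Lemma mspolyE p u : mspoly p u = p@_u. Proof. by []. Qed.

Lemma mspoly_additive : zmod_morphism mspoly.
Proof.
by move=> p q; apply/mseriesP => u; rewrite mscoefB !mspolyE mcoeffB.
Qed.

Lemma mspoly_multiplicative : monoid_morphism mspoly.
Proof.
split=> [|p q]; apply/mseriesP => u; first by rewrite mspolyE mcoeff1.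
by rewrite mspolyE -(@msmul_mpoly _ _ (mspoly p) (mspoly q)).
Qed.

HB.instance Definition _ :=
  GRing.isZmodMorphism.Build _ _ mspoly mspoly_additive.
HB.instance Definition _ :=
  GRing.isMonoidMorphism.Build _ _ mspoly mspoly_multiplicative.

Lemma mspolyXU i : mspoly 'X_i = msX K i.
Proof. by apply/mseriesP => u; rewrite mspolyE mcoeffX eq_sym. Qed.

Definition msC (c : K) : mseries n K := mspoly c%:MP.
HB.instance Definition _ :=
  GRing.RMorphism.copy msC (mspoly \o mpolyC n (R := K)).

Lemma mscoefC c u : msC c u = c * (u == 0%MM)%:R.
Proof. by rewrite /msC mspolyE mcoeffC. Qed.

Lemma mscoef_MC c F u : (msC c * F) u = c * F u.
Proof.
pose p := mstrunc (mdeg u).+1 F.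
have pF v : (mdeg v <= mdeg u)%N -> p@_v = F v by move=> vu; rewrite mstruncE.
by rewrite (@msmul_mpoly _ _ (msC c) F _ c%:MP p) // mcoeffCM pF.
Qed.

Lemma mscoefMXm m F u :
  (mspoly 'X_[m] * F) u = if (m <= u)%MM then F (u - m)%MM else 0.
Proof.
pose p := mstrunc (mdeg u).+1 F.
have pF v : (mdeg v <= mdeg u)%N -> p@_v = F v by move=> vu; rewrite mstruncE.
rewrite (@msmul_mpoly _ _ (mspoly 'X_[m]) F _ 'X_[m] p) //.
have [mu|mu] := ifPn.
  by rewrite -{1}(submK mu) addmC mulrC mcoeffMX pF // mdegB.
rewrite mcoeffM big1 // => vw /eqP e; rewrite mcoeffX.
case: eqP => [mv|_]; last by rewrite mul0r.
by case/negP: mu; rewrite e -mv lem_addr.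
Qed.

Lemma mscoefMX i F u :
  (msX K i * F) u = if (0 < u i)%N then F (u - U_(i))%MM else 0.
Proof.
rewrite -mspolyXU mscoefMXm; congr (if _ then _ else _).
apply/mnm_lepP/idP => [/(_ i)|ui j]; rewrite mnm1E ?eqxx //.
by case: eqP => // <-.
Qed.

End Coefficients.

Arguments msC {n K} c.
Arguments mspoly {n K} p.

(** * The filtration of power series by order *)

Section Order.
Variables (n : nat) (K : comNzRingType).
Implicit Types (F G : mseries n K).

(** Membership in the [d]-th power of the ideal generated by the variables. *)
Definition ord_ge d F := forall u, (mdeg u < d)%N -> F u = 0.

Lemma ord_ge0 F : ord_ge 0 F. Proof. by []. Qed.

(** The filtration is separated: the coefficient at [u] is already decided at level [mdeg u + 1]. *)
Lemma ord_ge_eq F G : (forall d, ord_ge d (F - G)) -> F = G.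
Proof.
move=> FG; apply/mseriesP => u; apply/eqP; rewrite -subr_eq0 -mscoefB.
by rewrite (FG (mdeg u).+1).
Qed.

Lemma ord_geD d F G : ord_ge d F -> ord_ge d G -> ord_ge d (F + G).
Proof. by move=> hF hG u ud; rewrite mscoefD hF ?hG ?addr0. Qed.

Lemma ord_geN d F : ord_ge d F -> ord_ge d (- F).
Proof. by move=> hF u ud; rewrite mscoefN hF ?oppr0. Qed.

Lemma ord_geM d e F G : ord_ge d F -> ord_ge e G -> ord_ge (d + e) (F * G).
Proof.
move=> hF hG u ud; rewrite mscoefM big1 // => vw /eqP uE.
have [vd|vd] := ltnP (mdeg vw.1) d; first by rewrite hF ?mul0r.
rewrite [X in _ * X]hG ?mulr0 // -(ltn_add2l d).
apply: (leq_ltn_trans _ ud); apply: (@leq_trans (mdeg vw.1 + mdeg vw.2)).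
  by rewrite leq_add2r.
by rewrite -mdegD -uE.
Qed.

Lemma ord_ge_prod (I : Type) (r : seq I) (d : I -> nat) (F : I -> mseries n K) :
  (forall i, ord_ge (d i) (F i)) ->
  ord_ge (\sum_(i <- r) d i) (\prod_(i <- r) F i).
Proof.
by move=> hF; elim/big_ind2: _ => // *; exact: ord_geM.
Qed.

Lemma ord_geXn d k F : ord_ge d F -> ord_ge (d * k) (F ^+ k).
Proof.
move=> hF; elim: k => [|k IH]; first by rewrite muln0; exact: ord_ge0.
by rewrite mulnS exprS; apply: ord_geM.
Qed.

Lemma ord_ge_sum (I : Type) (r : seq I) (Q : pred I) d (F : I -> mseries n K) :
  (forall i, Q i -> ord_ge d (F i)) -> ord_ge d (\sum_(i <- r | Q i) F i).
Proof.
by move=> hF; elim/big_ind: _ => // *; exact: ord_geD.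
Qed.

Lemma ord_ge1 F : ord_ge 1 F <-> F 0%MM = 0.
Proof.
split=> [->//|F0 u]; first by rewrite mdeg0.
by rewrite ltnS leqn0 mdeg_eq0 => /eqP->.
Qed.

Lemma ord_geX i : ord_ge 1 (msX K i).
Proof. by apply/ord_ge1; rewrite mscoefX eq_sym mnm1_eq0. Qed.

Lemma ord_ge_trunc d F : ord_ge d (F - mspoly (mstrunc d F)).
Proof. by move=> u ud; rewrite mscoefB mspolyE mstruncE ?subrr. Qed.

End Order.

(** * Continuous homomorphisms are determined on constants and variables *)

Section Hom.
Variables (n n' : nat) (K : comNzRingType).
Local Notation A := (mseries n K).
Local Notation B := (mseries n' K).

Definition order_preserving (phi : A -> B) :=
  forall d F, ord_ge d F -> ord_ge d (phi F).

(** The two maps agree on polynomials, and [F] differs from a truncation by a series of order at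
    least [d]. Preservation of order bounds [phi F - psi F] for every [d], and separatedness
    concludes. *)
Lemma mshom_eq (phi psi : {rmorphism A -> B}) :
  (forall c, phi (msC c) = psi (msC c)) ->
  (forall i, phi (msX K i) = psi (msX K i)) ->
  order_preserving phi -> order_preserving psi -> phi =1 psi.
Proof.
move=> eC eX ophi opsi F; apply: ord_ge_eq => d.
have eP p : phi (mspoly p) = psi (mspoly p).
  elim/mpolyind: p => [|c m p _ _ IH]; first by rewrite !rmorph0.
  rewrite !rmorphD IH -mul_mpolyC !rmorphM /=.
  rewrite -[mspoly c%:MP]/(msC c) eC mpolyXE_id !rmorph_prod.
  congr (_ * _ + _); apply: eq_bigr => i _.
  by rewrite !rmorphXn /= mspolyXU eX.
have -> : phi F - psi F =
    phi (F - mspoly (mstrunc d F)) - psi (F - mspoly (mstrunc d F)).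
  by rewrite !rmorphB /= eP opprB addrA subrK.
have h := ord_ge_trunc F (d := d).
by apply: ord_geD; [exact: ophi | apply: ord_geN; exact: opsi].
Qed.

End Hom.

(** * Substitution of series without constant term *)

Section Substitution.
Variables (n n' : nat) (K : comNzRingType) (g : 'I_n -> mseries n' K).
Local Notation A := (mseries n K).
Local Notation B := (mseries n' K).

(* Junk unless the [g i] have no constant term: only then does truncating [F]
   at degree [mdeg u] leave the coefficient at [u] unchanged. *)
Definition msubst (F : A) : B :=
  MSeries (fun u => mmap (@msC n' K) g (mstrunc (mdeg u).+1 F) u).

Hypothesis g0 : forall i, ord_ge 1 (g i).

(** A monomial of degree e goes to a product of e series of order at least 1, hence to order at
    least e. *)
Lemma ord_ge_mmap d (p : {mpoly K[n]}) :
  (forall v, (mdeg v < d)%N -> p@_v = 0) -> ord_ge d (mmap (@msC n' K) g p).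
Proof.
move=> p0; apply: ord_ge_sum => v _ u ud.
rewrite mscoef_MC; have [/p0->|vd] := ltnP (mdeg v) d; first by rewrite mul0r.
suff -> : mmap1 g v u = 0 by rewrite mulr0.
have := @ord_ge_prod _ _ _ (index_enum 'I_n) v (fun i => g i ^+ v i) _ u; apply.
  by move=> i; have := ord_geXn (k := v i) (g0 i); rewrite mul1n.
by rewrite -mdegE; apply: leq_trans vd.
Qed.

(** Terms of degree above [mdeg u] cannot reach the coefficient at [u]. The freedom in [p] lets ring
    identities for [msubst] be read off from [mmap] on polynomials. *)
Lemma msubstE (F : A) u (p : {mpoly K[n]}) :
  (forall v, (mdeg v <= mdeg u)%N -> p@_v = F v) ->
  msubst F u = mmap (@msC n' K) g p u.
Proof.
move=> pF; apply/eqP; rewrite -subr_eq0.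
rewrite -[msubst F u]/(mmap (@msC n' K) g _ u) -mscoefB -rmorphB /=.
apply/eqP; apply: (@ord_ge_mmap (mdeg u).+1) => // v vu.
by rewrite mcoeffB mstruncE // pF ?subrr.
Qed.

Lemma msubst_additive : zmod_morphism msubst.
Proof.
move=> F G; apply/mseriesP => u.
rewrite [RHS]mscoefB -[msubst F u]/(mmap (@msC n' K) g _ u).
rewrite -[msubst G u]/(mmap (@msC n' K) g _ u) -mscoefB -rmorphB /=.
apply: msubstE => v vu.
by rewrite mcoeffB !mstruncE.
Qed.

Lemma msubst_multiplicative : monoid_morphism msubst.
Proof.
split=> [|F G]; apply/mseriesP => u.
  rewrite (@msubstE _ _ 1) ?rmorph1 // => v _.
  by rewrite mcoeff1 mscoef1.
pose b := (mdeg u).+1.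
(* The product of the truncations is not the truncation of [F * G], but agrees with it through
   degree [mdeg u]. *)
rewrite (@msubstE _ _ (mstrunc b F * mstrunc b G)); last first.
  by move=> v vu; rewrite -msmul_trunc.
rewrite rmorphM /=; apply: eq_bigr => vw /eqP uE.
have du : mdeg u = (mdeg vw.1 + mdeg vw.2)%N by rewrite -mdegD -uE.
by congr (_ * _); apply/esym/msubstE => v vu;
  rewrite mstruncE // ltnS du (leq_trans vu) ?leq_addr ?leq_addl.
Qed.

Lemma msubst_order : order_preserving msubst.
Proof.
move=> d F hF u ud.
apply: (@ord_ge_mmap d) => // v vd.
have [vu|uv] := ltnP (mdeg v) (mdeg u).+1; first by rewrite mstruncE ?hF.
rewrite /mstrunc raddf_sum big1 //= => w _.
rewrite mcoeffZ mcoeffX; case: eqP => [wv|_]; last by rewrite mulr0.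
by have := bmdeg w; rewrite wv ltnNge uv.
Qed.

Lemma msubstX i : msubst (msX K i) = g i.
Proof.
apply/mseriesP => u; rewrite (@msubstE _ _ 'X_i) ?mmapX ?mmap1U //.
by move=> v _; rewrite mcoeffX mscoefX eq_sym.
Qed.

Lemma msubstC c : msubst (msC c) = (@msC n' K c).
Proof.
apply/mseriesP => u; rewrite (@msubstE _ _ c%:MP) ?mmapC // => v _.
Qed.

Definition msubst_hom : {rmorphism A -> B} :=
  HB.pack msubst (GRing.isZmodMorphism.Build _ _ msubst msubst_additive)
    (GRing.isMonoidMorphism.Build _ _ msubst msubst_multiplicative).

End Substitution.

(** * Power series in one variable, and inverses *)

Section OneVariable.
Variable K : comNzRingType.
Local Notation T := (msX K (ord0 : 'I_1)).
Implicit Types (F G : mseries 1 K) (u v : 'X_{1..1}).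

Lemma mnm_ord1 u : u = (U_(ord0) *+ mdeg u)%MM.
Proof.
by apply/mnmP => i; rewrite mulmnE mdegE big_ord1 (ord1 i) mnm1E eqxx mul1n.
Qed.

Lemma mspolyXn n (i : 'I_n) N : mspoly 'X_[U_(i) *+ N] = msX K i ^+ N.
Proof. by rewrite -mpolyXn rmorphXn /= mspolyXU. Qed.

Lemma mulmn1_le u N : (U_(ord0) *+ N <= u)%MM = (N <= mdeg u)%N.
Proof.
rewrite mdegE big_ord1; apply/mnm_lepP/idP => [/(_ ord0)|Nu i].
  by rewrite mulmnE mnm1E eqxx mul1n.
by rewrite mulmnE (ord1 i) mnm1E eqxx mul1n.
Qed.

(** Division by [T ^+ N], with the terms of degree below [N] dropped. *)
Definition msshift N F : mseries 1 K :=
  MSeries (fun v => F (v + U_(ord0) *+ N)%MM).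

Lemma msshiftE N F : ord_ge N F -> F = T ^+ N * msshift N F.
Proof.
move=> FN; apply/mseriesP => u; rewrite -mspolyXn mscoefMXm mulmn1_le.
case: leqP => [Nu|uN]; last by rewrite FN.
by rewrite /msshift /= submK // mulmn1_le.
Qed.

Lemma mulTn_eq0 N F : T ^+ N * F = 0 -> F = 0.
Proof.
move=> TF; apply/mseriesP => u.
have /mseriesP/(_ (u + U_(ord0) *+ N)%MM) := TF.
by rewrite -mspolyXn mscoefMXm lem_addl addmK.
Qed.

Lemma ord_ge1P N F :
  (forall j, (j < N)%N -> F (U_(ord0) *+ j)%MM = 0) -> ord_ge N F.
Proof. by move=> F0 u uN; rewrite [u]mnm_ord1 F0. Qed.

Definition msgeo : mseries 1 K := MSeries (fun _ => 1).

Lemma msgeoE : (1 - T) * msgeo = 1.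
Proof.
rewrite mulrBl mul1r; apply/mseriesP => u; rewrite mscoefB mscoefMX mscoef1 /=.
rewrite [u]mnm_ord1 mulmnE mnm1E eqxx mul1n -mdeg_eq0 mdegMn mdeg1 mul1n.
by case: (mdeg u) => [|d]; rewrite ?subr0 ?subrr.
Qed.

(** The identity for the geometric series in one variable is transported along the substitution of
    [F] for [T]. *)
Lemma msinv1B n (F : mseries n K) :
  F 0%MM = 0 -> exists G : mseries n K, (1 - F) * G = 1.
Proof.
move=> /ord_ge1 F0; have g0 (i : 'I_1) : ord_ge 1 F by [].
exists (msubst_hom g0 msgeo).
have := congr1 (msubst_hom g0) msgeoE.
rewrite rmorphM rmorphB rmorph1 /=. by rewrite msubstX.
Qed.

Lemma neg_argE F u : neg_arg F u = (-1) ^+ mdeg u * F u.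
Proof. by rewrite /= mdegE !big_ord1. Qed.

HB.instance Definition _ :=
  GRing.RMorphism.copy (@neg_arg K) (msscale (fun=> -1)).

Lemma neg_argK : involutive (@neg_arg K).
Proof.
by move=> F; apply/mseriesP => u; rewrite !neg_argE mulrA -expr2 sqrr_sign mul1r.
Qed.

End OneVariable.

(** * Over a field, k[[t]] is a discrete valuation ring *)

Section OneVariableField.
Variable K : fieldType.
Local Notation T := (msX K (ord0 : 'I_1)).
Implicit Types (F G : mseries 1 K) (u v : 'X_{1..1}).

(** Dividing by the constant term reduces to a series of the form 1 minus one without constant
    term. *)
Lemma msinv n (F : mseries n K) :
  F 0%MM != 0 -> exists G : mseries n K, F * G = 1.
Proof.
move=> F0; have [|G FG] := @msinv1B _ _ (1 - msC (F 0%MM)^-1 * F).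
  by rewrite mscoefB mscoef_MC mscoef1 eqxx mulVf ?subrr.
exists (msC (F 0%MM)^-1 * G).
by rewrite mulrCA mulrA -[RHS]FG subKr.
Qed.

Lemma mseries1_factor F : F != 0 ->
  exists N G, F = T ^+ N * G /\ G 0%MM != 0.
Proof.
move=> F0; have exN : exists N, F (U_(ord0) *+ N)%MM != 0.
  apply: contrapT => nF; case/eqP: F0; apply/mseriesP => u; rewrite [u]mnm_ord1.
  by apply/eqP; apply: contrapT => /negP uF; apply: nF; exists (mdeg u).
case: (ex_minnP exN) => N FN minN; exists N, (msshift N F); split.
  apply: msshiftE; apply: ord_ge1P => j jN; apply/eqP; apply: contraTT jN.
  by move=> /minN; rewrite -leqNgt.
by rewrite /= add0m.
Qed.

(** A nonzero [F] is a power of [T] times a unit, and both factors can be cancelled. *)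
Lemma mseries1_domain F G : F * G = 0 -> F = 0 \/ G = 0.
Proof.
move=> FG; have [->|F0] := eqVneq F 0; [by left|right].
have [N [E [FE /msinv[E' EE']]]] := mseries1_factor F0.
apply: (@mulTn_eq0 _ N); have := congr1 ( *%R E') FG.
by rewrite mulr0 FE => <-; rewrite mulrCA -mulrA (mulrA E) EE' mul1r.
Qed.

(** A member of least order divides all the others, being a unit times the power of [T] common to
    the family. *)
Lemma mseries1_family (I : finType) (F : I -> mseries 1 K) :
  (exists i, F i != 0) ->
  exists i0 (c : I -> mseries 1 K), F i0 != 0 /\ forall i, F i = c i * F i0.
Proof.
(* [N] will be the least degree at which some member has a nonzero coefficient, and [i0] such a
   member. *)
case=> i Fi; have exN : exists N, [exists i, F i (U_(ord0) *+ N)%MM != 0].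
  apply: contrapT => nF; case/eqP: Fi; apply/mseriesP => u; rewrite [u]mnm_ord1.
  apply/eqP; apply: contrapT => /negP uF; apply: nF; exists (mdeg u).
  by apply/existsP; exists i.
case: (ex_minnP exN) => N /existsP[i0 Fi0] minN.
have FE j : F j = T ^+ N * msshift N (F j).
  apply: msshiftE; apply: ord_ge1P => d dN; apply/eqP; apply: contraTT dN => Fj.
  by rewrite -leqNgt; apply: minN; apply/existsP; exists j.
have [|E FE0] := @msinv _ (msshift N (F i0)); first by rewrite /= add0m.
exists i0, (fun j => msshift N (F j) * E); split => [|j].
  by apply: contraNneq Fi0 => ->.
rewrite [F i0]FE {1}FE -[in LHS](mulr1 (msshift N (F j))) -FE0; ring.
Qed.

End OneVariableField.

(** * The embedding of k[[t]] into R *)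

Section SeriesInT.
Variables (K : comNzRingType) (m : nat).
Local Notation R := (mseries m.+1 K).
Local Notation T := (msX K (ord0 : 'I_1)).
Local Notation iota := (@series_in_t K m).

Lemma t_order : ord_ge 1 (var_t K m). Proof. exact: ord_geX. Qed.

(** Recognizing the coefficientwise embedding as a substitution gives its ring morphism laws and
    continuity at once. *)
Lemma series_in_tE (f : mseries 1 K) :
  iota f = msubst (fun=> var_t K m) f.
Proof.
apply/mseriesP => u /=; rewrite /mstrunc raddf_sum mscoef_sum /=.
under eq_bigr => v _ do
  rewrite mmapZ mscoef_MC mmapX /mmap1 big_ord1 -mspolyXn mspolyE mcoeffX.
case: ifPn => [/forallP u0|nu0]; last first.
  rewrite big1 // => v _; case: eqP => [vu|_]; last by rewrite mulr0.
  case/negP: nu0; apply/forallP => i.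
  by rewrite -vu mulmnE mnm1E mul0n.
have uE : u = (U_(ord0) *+ u ord0)%MM.
  apply/mnmP => i; rewrite mulmnE mnm1E; case: (unliftP ord0 i) => [j|] ->.
    by rewrite (eqP (u0 j)) mul0n.
  by rewrite eqxx mul1n.
have ltu : (mdeg [multinom u ord0 | _ < 1] < (mdeg u).+1)%N.
  by rewrite [in ltnRHS]uE mdegMn mdeg1 mul1n mdegE big_ord1 mnmE.
rewrite (bigD1 (BMultinom ltu)) //= mnmE -uE eqxx mulr1 big1 ?addr0 // => v nv.
case: eqP => [vu|_]; last by rewrite mulr0.
case/eqP: nv; apply/val_inj/mnmP => i /=; rewrite (ord1 i) mnmE.
by have /mnmP/(_ ord0) <- := vu; rewrite mulmnE mnm1E eqxx mul1n.
Qed.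

Lemma series_in_t_additive : zmod_morphism iota.
Proof. by move=> f g; rewrite !series_in_tE (msubst_additive (fun=> t_order)). Qed.

Lemma series_in_t_multiplicative : monoid_morphism iota.
Proof.
have [h1 hM] := @msubst_multiplicative _ _ _ _ (fun _ : 'I_1 => t_order).
by split=> [|f g]; rewrite !series_in_tE ?h1 ?hM.
Qed.

HB.instance Definition _ :=
  GRing.isZmodMorphism.Build _ _ iota series_in_t_additive.
HB.instance Definition _ :=
  GRing.isMonoidMorphism.Build _ _ iota series_in_t_multiplicative.

Lemma series_in_t_order : order_preserving iota.
Proof.
move=> d f fd; rewrite series_in_tE; apply: msubst_order => // _; exact: t_order.
Qed.

Lemma series_in_tC c : iota (msC c) = msC c.
Proof. by rewrite series_in_tE msubstC // => _; exact: t_order. Qed.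

Lemma sigma_series_in_t (f : mseries 1 K) :
  sigma (iota f) = iota (neg_arg f).
Proof.
apply/mseriesP => u /=; case: ifP => _; last by rewrite mulr0.
congr (_ * _); rewrite big_ord_recl big1 => [|i _]; last by rewrite expr1n.
by rewrite mulr1 big_ord1 mnmE.
Qed.

(** The first summand is F(t, 0). Every other monomial contains some x_i and is assigned to exactly
    one such i, chosen by [first]; [H i] collects the monomials assigned to i, divided by x_i. *)
Lemma series_decomp (F : R) : exists (H : 'I_m -> R),
  F = iota (MSeries (fun v => F (U_(ord0) *+ v ord0)%MM))
      + \sum_i var_x K i * H i.
Proof.
pose first (u : 'X_{1..m.+1}) := [pick i : 'I_m | (0 < u (lift ord0 i))%N].
exists (fun i => MSeries (fun u =>
  if first (u + U_(lift ord0 i))%MM == Some i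
  then F (u + U_(lift ord0 i))%MM else 0)).
apply/mseriesP => u; rewrite mscoefD mscoef_sum.
under eq_bigr => i _.
  rewrite mscoefMX /=.
  have -> : (if (0 < u (lift ord0 i))%N then
     if first (u - U_(lift ord0 i) + U_(lift ord0 i))%MM == Some i
     then F (u - U_(lift ord0 i) + U_(lift ord0 i))%MM else 0 else 0) =
     if Some i == first u then F u else 0.
    case: ifPn => [ui|ui].
      rewrite submK 1?eq_sym //; apply/mnm_lepP => j; rewrite mnm1E.
      by case: eqP => // <-.
    rewrite /first; case: pickP => // j uj; case: eqP => // -[ij].
    by move: ui; rewrite ij uj.
over.
rewrite /= {}/first; case: pickP => [i ui|u0].
  have -> : [forall i, u (lift ord0 i) == 0%N] = false.
    by apply/negbTE/forallPn; exists i; rewrite -lt0n.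
  rewrite add0r (bigD1 i) //= eqxx big1 ?addr0 // => j ji.
  by case: eqP => // -[ji']; rewrite ji' eqxx in ji.
have -> : [forall i, u (lift ord0 i) == 0%N].
  by apply/forallP => i; rewrite -leqn0 leqNgt u0.
rewrite big1 ?addr0 //.
rewrite mnmE; congr (F _); apply/mnmP => i; rewrite mulmnE mnm1E.
case: (unliftP ord0 i) => [j|] ->; last by rewrite eqxx mul1n.
by rewrite mul0n; apply/eqP; rewrite -leqn0 leqNgt u0.
Qed.

End SeriesInT.

(** * Generated ideals *)

Section IdealGen.
Variable A : comNzRingType.
Implicit Types (B J : set A) (a b c : A).

Definition ideal_closed J :=
  [/\ J 0, forall a b, J a -> J b -> J (a + b) & forall c a, J a -> J (c * a)].

Lemma ideal_closed_sum J (I : Type) (r : seq I) (Q : pred I) (F : I -> A) :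
  ideal_closed J -> (forall i, Q i -> J (F i)) -> J (\sum_(i <- r | Q i) F i).
Proof. by case=> J0 JD _ FJ; elim/big_ind: _ => //; apply: JD. Qed.

Lemma ideal_closedB J a b : ideal_closed J -> J a -> J b -> J (a - b).
Proof. by case=> _ JD JM aJ bJ; apply: JD => //; rewrite -mulN1r; apply: JM. Qed.

Lemma ideal_gen_min B J : ideal_closed J -> B `<=` J -> ideal_gen B `<=` J.
Proof.
move=> hJ BJ _ [n [c [b [Bb ->]]]]; apply: ideal_closed_sum => // i _.
by case: hJ => _ _; apply; apply: BJ.
Qed.

Lemma ideal_gen_sub B : B `<=` ideal_gen B.
Proof.
move=> b Bb; exists 1%N, (fun=> 1), (fun=> b); split=> // .
by rewrite big_ord1 mul1r.
Qed.

Lemma ideal_gen_closed B : ideal_closed (ideal_gen B).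
Proof.
split=> [|_ _ [n [c [b [Bb ->]]]] [n' [c' [b' [Bb' ->]]]]|d _ [n [c [b [Bb ->]]]]].
- exists 0%N, (fun=> 0), (fun=> 0); split; first by case.
  by rewrite big_ord0.
- pose cat (x : 'I_n -> A) (x' : 'I_n' -> A) i :=
    match split i with inl j => x j | inr j => x' j end.
  exists (n + n')%N, (cat c c'), (cat b b'); split.
    by move=> i; rewrite /cat; case: split.
  rewrite big_split_ord /cat /=; congr (_ + _); apply: eq_bigr => i _.
    by rewrite (unsplitK (inl i : 'I_n + 'I_n')).
  by rewrite (unsplitK (inr i : 'I_n + 'I_n')).
- exists n, (fun i => d * c i), b; split=> //.
  by rewrite big_distrr /=; apply: eq_bigr => i _; rewrite mulrA.
Qed.

Lemma ideal_gen_family n (b : 'I_n -> A) a :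
  ideal_gen [set b i | i in [set: 'I_n]] a <->
  exists c : 'I_n -> A, a = \sum_(i < n) c i * b i.
Proof.
split; last first.
  by case=> c ->; exists n, c, b; split=> // i; exists i.
case=> [n' [c [b' [Bb ->]]]].
have /choice[s sE] i : exists j, b j = b' i by have [j _ <-] := Bb i; exists j.
(* Terms that use the same generator, as recorded by [s], have their coefficients added up. *)
exists (fun j => \sum_(i < n' | s i == j) c i).
under [RHS]eq_bigr do rewrite big_distrl /=.
rewrite (exchange_big_dep xpredT) //=; apply: eq_bigr => i _.
by rewrite (big_pred1 (s i)) ?sE // => j; rewrite eq_sym.
Qed.

End IdealGen.

(** * The ideal of the curve x = f(t) in R *)

Section Curve.
Variables (K : fieldType) (m : nat).
Local Notation R := (mseries m.+1 K).
Local Notation T := (msX K (ord0 : 'I_1)).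
Local Notation iota := (@series_in_t K m).
Implicit Types (f g : 'I_m -> mseries 1 K) (F : R).

Definition curve_vals f (i : 'I_m.+1) : mseries 1 K :=
  if unlift ord0 i is Some j then f j else T.

Definition shear_vals f (i : 'I_m.+1) : R :=
  if unlift ord0 i is Some j then var_x K j + iota (f j) else var_t K m.

Definition curve_ideal f : set R :=
  ideal_gen [set var_x K i - iota (f i) | i in [set: 'I_m]].

Lemma curve_vals_order f :
  (forall i, f i 0%MM = 0) -> forall i, ord_ge 1 (curve_vals f i).
Proof.
move=> f0 i; rewrite /curve_vals; case: unlift => [j|]; last exact: ord_geX.
exact/ord_ge1.
Qed.

Lemma shear_vals_order f :
  (forall i, f i 0%MM = 0) -> forall i, ord_ge 1 (shear_vals f i).
Proof.
move=> f0 i; rewrite /shear_vals; case: unlift => [j|]; last exact: ord_geX.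
by apply: ord_geD; [exact: ord_geX|apply: series_in_t_order; apply/ord_ge1].
Qed.

(* F(t, x) |-> F(t, f(t)) *)
Definition curve_eval f (f0 : forall i, f i 0%MM = 0) :
  {rmorphism R -> mseries 1 K} := msubst_hom (curve_vals_order f0).

(* F(t, x) |-> F(t, x + f(t)) *)
Definition shear f (f0 : forall i, f i 0%MM = 0) : {rmorphism R -> R} :=
  msubst_hom (shear_vals_order f0).

Arguments curve_eval {f} f0.
Arguments shear {f} f0.

Section Eval.
Variables (f : 'I_m -> mseries 1 K) (f0 : forall i, f i 0%MM = 0).

Lemma curve_evalC c : curve_eval f0 (msC c) = msC c.
Proof. exact: msubstC (curve_vals_order f0) c. Qed.

Lemma curve_eval_x i : curve_eval f0 (var_x K i) = f i.
Proof.
by rewrite [LHS]msubstX; [rewrite /curve_vals liftK|exact: curve_vals_order].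
Qed.

Lemma curve_eval_t : curve_eval f0 (var_t K m) = T.
Proof.
by rewrite [LHS]msubstX; [rewrite /curve_vals unlift_none|exact: curve_vals_order].
Qed.

Lemma curve_eval_order : order_preserving (curve_eval f0).
Proof. exact: msubst_order (curve_vals_order f0). Qed.

Lemma shearC c : shear f0 (msC c) = msC c.
Proof. exact: msubstC (shear_vals_order f0) c. Qed.

Lemma shear_x i : shear f0 (var_x K i) = var_x K i + iota (f i).
Proof.
by rewrite [LHS]msubstX; [rewrite /shear_vals liftK|exact: shear_vals_order].
Qed.

Lemma shear_t : shear f0 (var_t K m) = var_t K m.
Proof.
by rewrite [LHS]msubstX; [rewrite /shear_vals unlift_none|exact: shear_vals_order].
Qed.

Lemma shear_order : order_preserving (shear f0).
Proof. exact: msubst_order (shear_vals_order f0). Qed.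

End Eval.

Opaque curve_eval shear.

Lemma curve_eval_series_in_t f (f0 : forall i, f i 0%MM = 0)
  (g : mseries 1 K) :
  curve_eval f0 (iota g) = g.
Proof.
apply: (mshom_eq (phi := curve_eval f0 \o iota) (psi := idfun)) => //=.
- by move=> c; rewrite series_in_tC curve_evalC.
- by move=> i; rewrite (ord1 i) series_in_tX; rewrite curve_eval_t.
- by move=> d F Fd; exact: curve_eval_order (series_in_t_order Fd).
Qed.

Lemma shear_series_in_t f (f0 : forall i, f i 0%MM = 0) (g : mseries 1 K) :
  shear f0 (iota g) = iota g.
Proof.
apply: (mshom_eq (phi := shear f0 \o iota) (psi := iota)) => //=.
- by move=> c; rewrite series_in_tC shearC.
- by move=> i; rewrite (ord1 i) series_in_tX; rewrite shear_t.
- by move=> d F Fd; exact: shear_order (series_in_t_order Fd).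
- exact: series_in_t_order.
Qed.

(** Makes [shear] an automorphism; it sends x_i - f_i to x_i and so straightens the curve to x =
    0. *)
Lemma shearK f g (f0 : forall i, f i 0%MM = 0) (g0 : forall i, g i 0%MM = 0) F :
  (forall i, g i = - f i) -> shear g0 (shear f0 F) = F.
Proof.
move=> gE; apply: (mshom_eq (phi := shear g0 \o shear f0)
  (psi := idfun)) => //=.
- by move=> c; rewrite !shearC.
- move=> i; case: (unliftP ord0 i) => [j|] ->; last first.
    by rewrite -[LHS]/(shear g0 (shear f0 (var_t K m))) !shear_t.
  rewrite -[LHS]/(shear g0 (shear f0 (var_x K j))) shear_x.
  by rewrite rmorphD shear_x shear_series_in_t gE rmorphN addrNK.
- by move=> d G Gd; exact: shear_order (shear_order f0 Gd).
Qed.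

(** Generators vanish on the curve. Conversely, [series_decomp] is applied to the sheared series,
    where the curve is x = 0; shearing back writes [F] as an element of the ideal plus a series [h]
    in t, and evaluation on the curve forces [h] to vanish. *)
Lemma curve_idealP f (f0 : forall i, f i 0%MM = 0) F :
  curve_ideal f F <-> curve_eval f0 F = 0.
Proof.
have [_ _ QM] := ideal_gen_closed [set var_x K i - iota (f i) | i in [set: 'I_m]].
have Qsub : curve_ideal f `<=` [set G | curve_eval f0 G = 0].
  apply: ideal_gen_min => [|_ [i _ <-]]; last first.
    by rewrite /= rmorphB curve_eval_x curve_eval_series_in_t subrr.
  split=> [|a b /= a0 b0|c a /= a0]; first exact: rmorph0.
    by rewrite rmorphD a0 b0 addr0.
  by rewrite rmorphM a0 mulr0.
split=> [/Qsub //|F0].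
have f0' i : (- f i) 0%MM = 0 by rewrite mscoefN f0 oppr0.
have [H] := series_decomp (shear f0 F).
set h := MSeries _ => /(congr1 (@shear (fun i => - f i) f0')).
rewrite shearK // rmorphD rmorph_sum shear_series_in_t => FE.
have QF : curve_ideal f (F - iota h).
  rewrite FE addrC addKr; apply: ideal_closed_sum (ideal_gen_closed _) _ => i _.
  rewrite rmorphM shear_x rmorphN mulrC; apply: QM.
  by apply: ideal_gen_sub; exists i.
have := Qsub _ QF; rewrite /= rmorphB /= F0 sub0r => /eqP.
rewrite oppr_eq0 [X in X == _]curve_eval_series_in_t => /eqP h0.
by move: QF; rewrite h0 rmorph0 subr0.
Qed.

(** The ideal is the kernel of a morphism to the domain k[[t]]. *)
Lemma curve_ideal_prime f :
  (forall i, f i 0%MM = 0) -> prime_ideal (curve_ideal f).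
Proof.
move=> f0; pose e := curve_eval f0.
have QE G : (G \in curve_ideal f) = (e G == 0).
  by apply/idP/eqP => [/set_mem/(curve_idealP f0)|/(curve_idealP f0)/mem_set].
split; last first.
  move=> F G; rewrite !QE rmorphM => /eqP/mseries1_domain.
  by case=> ->; rewrite eqxx ?orbT.
split=> [||a F G]; rewrite !QE ?rmorph0 ?rmorph1 ?oner_eq0 // => /eqP F0 /eqP G0.
by rewrite rmorphD rmorphM F0 G0 mulr0 addr0.
Qed.

End Curve.

#[global] Opaque curve_eval.

(** * Formal partial derivatives *)

Section Derivative.
Variables (n : nat) (K : comNzRingType) (i : 'I_n).
Implicit Types (F G : mseries n K).

Definition msderiv F : mseries n K :=
  MSeries (fun u => F (u + U_(i))%MM *+ (u i).+1).

Lemma msderiv_additive : zmod_morphism msderiv.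
Proof. by move=> F G; apply/mseriesP => u /=; rewrite -mulrnBl. Qed.

HB.instance Definition _ :=
  GRing.isZmodMorphism.Build _ _ msderiv msderiv_additive.

Lemma msderivM F G : msderiv (F * G) = msderiv F * G + F * msderiv G.
Proof.
(* Differentiation lowers the degree by one, so the truncations must keep degree [mdeg u + 1]. *)
apply/mseriesP => u; pose b := (mdeg u).+2.
have dE H v : (mdeg v <= mdeg u)%N -> (mderiv i (mstrunc b H))@_v = msderiv H v.
  by move=> vu; rewrite mcoeff_deriv mstruncE // mdegD mdeg1 addn1 ltnS.
have tE (H : mseries n K) v : (mdeg v <= mdeg u)%N -> (mstrunc b H)@_v = H v.
  by move=> vu; rewrite mstruncE // ltnS leqW.
have ub : (mdeg (u + U_(i))%MM < b)%N by rewrite mdegD mdeg1 addn1.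
rewrite -[LHS]/(msmul F G (u + U_(i))%MM *+ (u i).+1) (msmul_trunc F G ub).
rewrite -mcoeff_deriv mderivM mcoeffD.
by rewrite mscoefD -(msmul_mpoly (dE F) (tE G)) -(msmul_mpoly (tE F) (dE G)).
Qed.

Lemma msderivX j : msderiv (msX K j) = (i == j)%:R.
Proof.
apply/mseriesP => u; rewrite /msderiv /=.
have [->|ij] := eqVneq i j.
  rewrite -{2}[U_(j)%MM]add0m eqm_add2r mscoef1.
  by case: eqP => [->|_]; rewrite ?mnm0E // mul0rn.
case: eqP => [/mnmP/(_ i)|_]; last by rewrite mul0rn.
by rewrite mnmDE !mnm1E eqxx eq_sym (negPf ij) addn1.
Qed.

End Derivative.

Lemma msderiv_series_in_t (K : comNzRingType) m (i : 'I_m) (f : mseries 1 K) :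
  msderiv (lift ord0 i) (series_in_t m f) = 0.
Proof.
apply/mseriesP => u /=; case: ifP => [/forallP/(_ i)|_]; last by rewrite mul0rn.
by rewrite mnmDE mnm1E eqxx addn1.
Qed.

(** * Symbolic powers of a prime, with denominators cleared *)

Section SymbolicPower.
Variable A : comNzRingType.
Implicit Types (J P : set A) (a u : A).

(** Fractions with numerator in [J] already form an ideal of the localization, so [loc_of p a] is
    one of them; equality of fractions then supplies the multiplier. *)
Lemma loc_ideal_gen (p : prime_idealr A) J a :
  ideal_closed J -> ideal_gen [set loc_of p b | b in J] (loc_of p a) ->
  exists2 u, u \notin p & J (u * a).
Proof.
case=> J0 JD JM.
pose L : set (loc p) :=
  [set x | exists b s (sp : s \notin p), J b /\ x = loc_frac b sp].
have /ideal_gen_min sub : ideal_closed L.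
  split.
  - by exists 0, 1, (loc_one_notin p).
  - move=> _ _ [b [s [sp [Jb ->]]]] [c [t [tp [Jc ->]]]].
    exists (b * t + c * s), (s * t), (loc_mul_notin sp tp).
    split; last exact: loc_addE.
    by apply: JD; rewrite mulrC; apply: JM.
  - move=> x _ [b [s [sp [Jb ->]]]]; have [c [t [tp ->]]] := loc_fracP x.
    exists (c * b), (t * s), (loc_mul_notin tp sp).
    by split; [exact: JM | exact: loc_mulE].
have /sub{}sub : [set loc_of p b | b in J] `<=` L.
  by move=> _ [b Jb <-]; exists b, 1, (loc_one_notin p).
move=> /sub[b [s [sp [Jb /loc_frac_eq[u up]]]]].
rewrite mulr1 mulrBr => /eqP; rewrite subr_eq0 => /eqP E.
exists (u * s); first exact: loc_mul_notin.
by rewrite -mulrA (mulrC s) E; apply: JM.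
Qed.

Definition prime_idealr_of P (primeP : prime_ideal P) : prime_idealr A :=
  HB.pack (fun a : A => a \in P) (isIdealr.Build A _ primeP.1)
    (isPrimeIdealrClosed.Build A _ primeP.2).

(** A prime is associated to itself, with witness 1, so the defining condition can be used at
    [P]. *)
Lemma symbolic_power_prime P n a : prime_ideal P -> symbolic_power P n a ->
  exists2 u, ~ P u & ideal_pow P n (u * a).
Proof.
move=> primeP /(_ (prime_idealr_of primeP)) h.
have /h : assoc_prime P (prime_idealr_of primeP).
  by exists 1 => b; rewrite mulr1; split=> [/set_mem|/mem_set].
case/(loc_ideal_gen (ideal_gen_closed _)) => u up Pu; exists u => //.
by move=> /mem_set; apply/negP.
Qed.

Lemma prime_idealM P a u : prime_ideal P -> P (u * a) -> ~ P u -> P a.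
Proof.
by case=> _ hP /mem_set/hP/orP[/set_mem//|/set_mem].
Qed.

Lemma prime_ideal_closed P : prime_ideal P -> ideal_closed P.
Proof.
case=> -[/set_mem P0 _ hP] _; split=> // [a b /mem_set Pa /mem_set Pb|c a /mem_set Pa].
  by apply: set_mem; rewrite -(mul1r a); apply: hP.
by apply: set_mem; rewrite -[c * a]addr0; apply: hP => //; apply: mem_set.
Qed.

End SymbolicPower.

(** * The subring S as the invariants of [sigma] *)

Section Even.
Variables (K : fieldType) (m : nat).
Hypothesis two0 : (2 : K) != 0.
Local Notation R := (mseries m.+1 K).
Local Notation S := (even_series K m).
Local Notation iota := (@series_in_t K m).
Implicit Types (F G : R).

Lemma mulr2_eq0 n (F : mseries n K) : F *+ 2 = 0 -> F = 0.
Proof.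
move=> F2; apply/mseriesP => u; have /mseriesP/(_ u) := F2.
rewrite mulr2n mscoefD -mulr2n -mulr_natl => /eqP.
by rewrite mulf_eq0 (negPf two0) => /eqP.
Qed.

Lemma sigmaE F u : sigma F u = (-1) ^+ u ord0 * F u.
Proof. by rewrite /= big_ord_recl /= big1 ?mulr1 // => i _; rewrite expr1n. Qed.

(** At an odd power of t, [sigma] negates the coefficient, so invariance kills twice that
    coefficient. *)
Lemma even_tE F : F \in @even_t K m <-> sigma F = F.
Proof.
split=> [/asboolP eF|sF].
  apply/mseriesP => u; rewrite sigmaE -signr_odd.
  by have [/eF->|_] := boolP (odd (u ord0)); rewrite ?mulr0 // mul1r.
apply/asboolP => u ou; have /mseriesP/(_ u) := sF.
rewrite sigmaE -signr_odd ou expr1 mulN1r => /eqP.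
rewrite eq_sym -addr_eq0 -mulr2n -mulr_natl mulf_eq0 (negPf two0) => /eqP.
exact.
Qed.

Lemma sigmaC c : @sigma K m (msC c) = msC c.
Proof.
apply/mseriesP => u; rewrite sigmaE mscoefC; case: eqP => [->|_].
  by rewrite mnm0E mul1r.
by rewrite !mulr0.
Qed.

(** The averaging (Reynolds) operator for the group generated by [sigma]: an S-linear retraction of
    R onto S. *)
Definition even_part F : R := msC 2^-1 * (F + sigma F).

Lemma even_partP F : even_part F \in @even_t K m.
Proof.
by apply/even_tE; rewrite rmorphM rmorphD /= sigmaC sigmaK addrC.
Qed.

Lemma even_part_id F : F \in @even_t K m -> even_part F = F.
Proof.
move=> /even_tE sF; rewrite /even_part sF -mulr2n -(mulr_natl F) mulrA.
by rewrite -(rmorph_nat msC 2) -rmorphM mulVf // rmorph1 mul1r.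
Qed.

Lemma even_partM F G : G \in @even_t K m -> even_part (F * G) = even_part F * G.
Proof.
by move=> /even_tE sG; rewrite /even_part rmorphM /= sG -mulrDl mulrA.
Qed.

Lemma even_part_sum (I : Type) (r : seq I) (F : I -> R) :
  even_part (\sum_(i <- r) F i) = \sum_(i <- r) even_part (F i).
Proof. by rewrite /even_part rmorph_sum -big_split big_distrr /=. Qed.

Lemma even_val_inj (s s' : S) : even_val s = even_val s' -> s = s'.
Proof. exact: val_inj. Qed.

(** Averaging the relation fixes [a] and each [z i] and moves the coefficients into S. Thus an ideal
    of S is recovered from its extension to R. *)
Lemma even_combination r (z : 'I_r -> S) (a : S) (G : 'I_r -> R) :
  even_val a = \sum_(i < r) G i * even_val (z i) ->
  exists g : 'I_r -> S, a = \sum_(i < r) g i * z i.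
Proof.
move=> aE; exists (fun i => EvenSeries (even_partP (G i))).
apply: even_val_inj; rewrite [RHS](rmorph_sum val).
rewrite -[LHS]even_part_id ?(valP a) // aE even_part_sum.
by apply: eq_bigr => i _; rewrite even_partM // (valP (z i)).
Qed.

(** Over R, [series_decomp] and the divisibility of F(t, 0) by t^2 express the element through t^2
    and the x_i; averaging moves the coefficients into S. *)
Lemma even_max_ideal (s : S) : even_val s 0%MM = 0 ->
  ideal_gen ([set even_t2 K m] `|` [set even_x K i | i in [set: 'I_m]]) s.
Proof.
move=> s0; have [_ JD JM] := ideal_gen_closed
  ([set even_t2 K m] `|` [set even_x K i | i in [set: 'I_m]]).
have [H] := series_decomp (even_val s); set h := MSeries _.
(* The coefficient in degree 0 vanishes by hypothesis, the one in degree 1 by evenness. *)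
have h2 : ord_ge 2 h.
  apply: ord_ge1P => -[|[|//]] _; rewrite /h /= mulmnE mnm1E eqxx.
    by rewrite mulm0n.
  by have /asboolP := valP s; apply; rewrite mulmnE mnm1E.
rewrite (msshiftE h2) rmorphM rmorphXn /= series_in_tX => sE.
have [|g ->] := @even_combination m.+1
  (fun i => if unlift ord0 i is Some j then even_x K j else even_t2 K m) s
  (fun i => if unlift ord0 i is Some j then H j
            else iota (msshift 2 h)).
  rewrite sE big_ord_recl unlift_none mulrC; congr (_ + _).
  by apply: eq_bigr => i _; rewrite liftK mulrC.
apply: ideal_closed_sum (ideal_gen_closed _) _ => i _; apply: JM.
apply: ideal_gen_sub; case: unlift => [j|]; last by left.
by right; exists j.
Qed.

End Even.

(** * The contraction P and a Jacobian criterion for its symbolic square *)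

Section Contraction.
Variables (K : fieldType) (m : nat).
Local Notation R := (mseries m.+1 K).
Local Notation S := (even_series K m).
Local Notation iota := (@series_in_t K m).
Implicit Types (F G : R) (f : 'I_m -> mseries 1 K).

Definition curve_contraction f : set S := [set s | curve_ideal f (even_val s)].

Definition even_max : set S :=
  ideal_gen ([set even_t2 K m] `|` [set even_x K i | i in [set: 'I_m]]).

Lemma sigma_curve_ideal f F :
  curve_ideal f F -> curve_ideal (fun i => neg_arg (f i)) (sigma F).
Proof.
have [Q0 QD QM] := ideal_gen_closed
  [set var_x K i - iota (neg_arg (f i)) | i in [set: 'I_m]].
move: F; apply: ideal_gen_min => [|_ [i _ <-]].
  split=> [|F G hF hG|G F hF] /=; first by rewrite rmorph0.
    by rewrite rmorphD; apply: QD.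
  by rewrite rmorphM; apply: QM.
apply: ideal_gen_sub; exists i => //.
by rewrite rmorphB /= sigma_x sigma_series_in_t.
Qed.

Lemma sigma_curve_ideal_image f :
  @sigma K m @` curve_ideal f = curve_ideal (fun i => neg_arg (f i)).
Proof.
apply/seteqP; split=> [_ [F QF <-]|F QF]; first exact: sigma_curve_ideal.
exists (sigma F); last exact: sigmaK.
have -> : f = fun i => neg_arg (neg_arg (f i)).
  by apply/funext => i; rewrite neg_argK.
exact: sigma_curve_ideal.
Qed.

Hypothesis two0 : (2 : K) != 0.

(** [sigma] exchanges the two curve ideals and fixes every element of S. *)
Lemma curve_contraction_neg f :
  curve_contraction f = curve_contraction (fun i => neg_arg (f i)).
Proof.
have sub g : curve_contraction g `<=` curve_contraction (fun i => neg_arg (g i)).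
  move=> s /sigma_curve_ideal; rewrite /curve_contraction /=.
  by rewrite (iffLR (even_tE two0 _) (valP s)).
apply/seteqP; split; first exact: sub.
rewrite [X in _ `<=` curve_contraction X](_ : f = fun i => neg_arg (neg_arg (f i))).
  exact: sub.
by apply/funext => i; rewrite neg_argK.
Qed.

Section Prime.
Variables (f : 'I_m -> mseries 1 K) (f0 : forall i, f i 0%MM = 0).
Local Notation Q := (curve_ideal f).
Local Notation P := (curve_contraction f).

Lemma curve_contraction_prime : prime_ideal P.
Proof.
have [[_ Q1 _] Qprime] := curve_ideal_prime f0.
have PE (s : S) : (s \in P) = (even_val s \in Q).
  by apply/idP/idP => [/set_mem h|/set_mem h]; apply/mem_set.
have [Q0 QD QM] := ideal_gen_closed [set var_x K i - iota (f i) | i in [set: 'I_m]].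
split; last by move=> s t; rewrite !PE; exact: Qprime.
split=> [||a s t]; rewrite ?PE //; first exact/mem_set.
move=> /set_mem Qs /set_mem Qt; apply/mem_set.
by apply: QD => //; apply: QM.
Qed.

Lemma curve_ideal_const F : Q F -> F 0%MM = 0.
Proof.
move: F; apply: ideal_gen_min => [|_ [i _ <-]].
  split=> [|F G F0 G0|G F F0] //; first by rewrite /= F0 G0 addr0.
  by apply/ord_ge1; rewrite -[1%N]add0n; apply: ord_geM => //; apply/ord_ge1.
apply/ord_ge1; apply: ord_geD; first exact: ord_geX.
by apply: ord_geN; apply: series_in_t_order; apply/ord_ge1.
Qed.

Lemma curve_contraction_max : P `<=` even_max.
Proof. by move=> s /curve_ideal_const; apply: even_max_ideal. Qed.

(** By the Leibniz rule, derivatives of elements of P^2 lie in Q. If u a is in P^2 with u outside P,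
    then a is in P by primality; hence u D(a) = D(u a) - a D(u) is in Q, and Q is prime. The
    derivatives are taken in R, so they land in Q rather than in P. *)
Lemma symbolic_square_deriv (a : S) :
  symbolic_power P 2 a -> P a /\ forall i, Q (msderiv i (even_val a)).
Proof.
have primeP := curve_contraction_prime.
have [P0 PD PM] := prime_ideal_closed primeP.
have primeQ := curve_ideal_prime f0.
have [Q0 QD QM] := prime_ideal_closed primeQ.
case/(symbolic_power_prime primeP) => u nPu.
have sub : ideal_pow P 2 `<=`
    [set b | P b /\ forall i, Q (msderiv i (even_val b))].
  apply: ideal_gen_min => [|_ [b Pb <-]].
    split=> /= [|b c [Pb Qb] [Pc Qc]|c b [Pb Qb]].
    - by split=> // i; rewrite (raddf0 (msderiv i)).
    - split; first exact: PD.
      by move=> i; rewrite (raddfD (msderiv i)); apply: QD; [exact: Qb|exact: Qc].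
    - split; first exact: PM.
      move=> i; rewrite (msderivM i (even_val c)).
      by apply: QD; apply: QM; [exact: Pb|exact: Qb].
  rewrite big_ord_recl big_ord1 /=; split; first exact: PM.
  move=> i; rewrite (msderivM i (even_val (b ord0))).
  by apply: QD; [|rewrite mulrC]; apply: QM; apply: Pb.
move=> /sub[Pua Qua]; have Pa := prime_idealM primeP Pua nPu.
split=> // i; apply: (prime_idealM primeQ) (nPu).
have := ideal_closedB (prime_ideal_closed primeQ) (Qua i)
  (QM (msderiv i (even_val u)) _ Pa).
by rewrite (msderivM i (even_val u)) addrC addKr.
Qed.

(** Differentiating a = sum g_i z_i, the terms D(g_i) z_i fall into Q, so sum g_i D(z_i) is in Q.
    The last hypothesis says that these relations have only the zero solution modulo Q, that is, the
    Jacobian is nonsingular there; so each g_i is in P, hence in the maximal ideal. Coefficients in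
    R suffice in the second hypothesis because [even_combination] moves them into S. *)
Lemma jacobian_criterion (z : 'I_m -> S) :
  (forall i, P (z i)) ->
  (forall a, P a -> exists G : 'I_m -> R,
     even_val a = \sum_i G i * even_val (z i)) ->
  (forall g : 'I_m -> R,
     (forall j, Q (\sum_i g i * msderiv (lift ord0 j) (even_val (z i)))) ->
     forall i, Q (g i)) ->
  symbolic_power P 2 `<=` ideal_mul even_max P.
Proof.
have primeQ := curve_ideal_prime f0.
have [Q0 QD QM] := prime_ideal_closed primeQ.
move=> Pz genP jac a /symbolic_square_deriv[/genP[G aE] Qa].
have [g {aE}aE] := even_combination two0 aE.
suff Pg i : P (g i).
  rewrite aE; apply: ideal_closed_sum (ideal_gen_closed _) _ => i _.
  apply: ideal_gen_sub; exists (g i); first exact: curve_contraction_max.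
  by exists (z i).
apply: (jac (fun i => even_val (g i))) => j.
have := Qa (lift ord0 j); rewrite aE [even_val _](rmorph_sum val).
rewrite (raddf_sum (msderiv (lift ord0 j))) /=.
under eq_bigr do rewrite msderivM.
rewrite big_split /=; set D := \sum_i _ => QDD.
have QD1 : Q D.
  apply: ideal_closed_sum (ideal_gen_closed _) _ => l _.
  by apply: QM; apply: Pz.
have := ideal_closedB (prime_ideal_closed primeQ) QDD QD1.
by rewrite addrAC subrr add0r.
Qed.

End Prime.
End Contraction.

(** The generators x_i - f_i of Q already lie in S, and their Jacobian is the identity matrix. *)
Lemma symbolic_square_even (K : fieldType) (m : nat) (f : 'I_m -> mseries 1 K) :
  (2 : K) != 0 -> (forall i, f i 0%MM = 0) -> (forall i, neg_arg (f i) = f i) ->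
  symbolic_power (curve_contraction f) 2 `<=`
    ideal_mul (@even_max K m) (curve_contraction f).
Proof.
move=> two0 f0 fE.
have ze i : var_x K i - series_in_t m (f i) \in @even_t K m.
  by apply/(even_tE two0); rewrite rmorphB /= sigma_x sigma_series_in_t fE.
apply: (@jacobian_criterion _ _ two0 _ f0 (fun i => EvenSeries (ze i))) => /=.
- by move=> i; apply: ideal_gen_sub; exists i.
- by move=> a /ideal_gen_family[G aE]; exists G.
move=> g Qg i; have := Qg i.
rewrite (bigD1 i) //= raddfB /= msderiv_series_in_t msderivX eqxx subr0 mulr1.
rewrite big1 ?addr0 // => j ji.
rewrite raddfB /= msderiv_series_in_t msderivX (inj_eq (@lift_inj _ _)).
by rewrite eq_sym (negPf ji) subr0 mulr0.
Qed.

(** * The case of a nonzero odd part *)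

Section Ramified.
Variables (K : fieldType) (m : nat).
Hypothesis two0 : (2 : K) != 0.
Local Notation R := (mseries m.+1 K).
Local Notation S := (even_series K m).
Local Notation iota := (@series_in_t K m).
Variables (a c : 'I_m -> mseries 1 K) (o : mseries 1 K) (i0 : 'I_m).
Hypotheses (aE : forall i, neg_arg (a i) = a i)
  (cE : forall i, neg_arg (c i) = c i) (oE : neg_arg o = - o)
  (o0 : o != 0) (ci0 : c i0 = 1).

(** The values [o] and [- o] of [s] give the curves of Q1 and Q2. *)
Let branch (s : mseries 1 K) i := a i + c i * s.
Hypotheses (fo0 : forall i, branch o i 0%MM = 0)
  (fn0 : forall i, branch (- o) i 0%MM = 0).

Let w : R := var_x K i0 - iota (a i0).

(* The power series in [t^2] and [w] that vanish on the curve are the multiples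
   of [w^2 - o^2], as [o] is odd; the other coordinates are linear in [w]. *)
Let gens (i : 'I_m) : R :=
  if i == i0 then w ^+ 2 - iota (o ^+ 2)
  else var_x K i - iota (a i) - iota (c i) * w.

Let gens_even i : gens i \in @even_t K m.
Proof.
have we : sigma w = w by rewrite rmorphB /= sigma_x sigma_series_in_t aE.
apply/(even_tE two0); rewrite /gens; case: eqP => _.
  by rewrite rmorphB rmorphXn /= we sigma_series_in_t rmorphXn /= oE sqrrN.
by rewrite 2!rmorphB rmorphM /= we sigma_x !sigma_series_in_t aE cE.
Qed.

Let Z : set R := ideal_gen [set gens i | i in [set: 'I_m]].

Let branch_w s (s0 : forall i, branch s i 0%MM = 0) : curve_eval s0 w = s.
Proof.
rewrite rmorphB /= curve_eval_x curve_eval_series_in_t /branch ci0 mul1r.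
by rewrite addrC addKr.
Qed.

Let branch_gens s (s0 : forall i, branch s i 0%MM = 0) i :
  s ^+ 2 = o ^+ 2 -> curve_eval s0 (gens i) = 0.
Proof.
move=> so; rewrite /gens; case: eqP => _.
  by rewrite rmorphB rmorphXn /= branch_w curve_eval_series_in_t so subrr.
rewrite 2!rmorphB rmorphM /= branch_w curve_eval_x !curve_eval_series_in_t.
by rewrite /branch -addrA -opprD subrr.
Qed.

(** Modulo [Z], each x_i - a_i - c_i s is congruent to c_i (w - s), so the curve ideal becomes
    principal, generated by w - s. *)
Let branch_mod s F : curve_ideal (branch s) F ->
  exists G, Z (F - G * (w - iota s)).
Proof.
case/ideal_gen_family => G ->; exists (\sum_i G i * iota (c i)).
rewrite big_distrl -sumrB; apply: ideal_closed_sum (ideal_gen_closed _) _ => i _.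
have [_ _ ZM] := ideal_gen_closed [set gens i | i in [set: 'I_m]].
rewrite /= -mulrA -mulrBr; apply: ZM.
have [->|ii0] := eqVneq i i0.
  rewrite ci0 rmorph1 mul1r /branch /w ci0 mul1r rmorphD /=.
  rewrite opprD addrA subrr.
  by have [] := ideal_gen_closed [set gens i | i in setT].
apply: ideal_gen_sub; exists i => //.
rewrite /gens (negPf ii0) /branch rmorphD rmorphM /=; ring.
Qed.

(** Modulo [Z], F is G (w - o). On the curve for [- o] this gives 2 o G = 0, so G vanishes there and
    is H (w + o) modulo [Z]; finally (w - o)(w + o) is the generator at [i0]. *)
Let gens_generate F :
  curve_ideal (branch o) F -> curve_ideal (branch (- o)) F -> Z F.
Proof.
move=> /branch_mod[G ZG] /(curve_idealP fn0) F0.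
have [_ ZD ZM] := ideal_gen_closed [set gens i | i in [set: 'I_m]].
have Z0 H : Z H -> curve_eval fn0 H = 0.
  case/ideal_gen_family => d ->; rewrite rmorph_sum big1 // => i _.
  by rewrite rmorphM /= branch_gens ?mulr0 ?sqrrN.
have := Z0 _ ZG; rewrite rmorphB rmorphM rmorphB /= F0 branch_w.
rewrite curve_eval_series_in_t sub0r -opprD mulrN opprK -mulr2n mulrnAr.
move=> /(mulr2_eq0 two0)/mseries1_domain[/(curve_idealP fn0)|]; last first.
  by move/eqP; rewrite (negPf o0).
move=> /branch_mod[H ZH].
have -> : F = (F - G * (w - iota o)) + (w - iota o) * (G - H * (w - iota (- o)))
    + H * gens i0.
  rewrite /gens eqxx rmorphN rmorphXn /=; ring.
apply: (ZD); first by apply: (ZD) => //; apply: (ZM).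
by apply: (ZM); apply: ideal_gen_sub; exists i0.
Qed.

(** The Jacobian is triangular, with diagonal entries 1 away from [i0] and 2 w at [i0]; on the curve
    w takes the nonzero value [o]. *)
Lemma symbolic_square_ramified :
  symbolic_power (curve_contraction (branch o)) 2 `<=`
    ideal_mul (@even_max K m) (curve_contraction (branch o)).
Proof.
have negE : (fun i => neg_arg (branch o i)) = branch (- o).
  by apply/funext => i; rewrite /branch rmorphD rmorphM /= aE cE oE.
apply: (@jacobian_criterion _ _ two0 _ fo0 (fun i => EvenSeries (gens_even i))) => /=.
- by move=> i; apply/(curve_idealP fo0)/branch_gens.
(* An element of P vanishes on both curves, since P is also the contraction of the conjugate
   ideal. *)
- move=> b Pb; apply/ideal_gen_family; apply: gens_generate => //.
  by move: (Pb); rewrite curve_contraction_neg // negE.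
have dw j : msderiv (lift ord0 j) w = (j == i0)%:R.
  by rewrite raddfB /= msderiv_series_in_t subr0 msderivX (inj_eq (@lift_inj _ _)).
have dz0 j : msderiv (lift ord0 j) (gens i0) = (w * (j == i0)%:R) *+ 2.
  rewrite /gens eqxx raddfB /= msderiv_series_in_t subr0 expr2 msderivM dw.
  by rewrite mulrC -mulr2n.
have dz j i : i != i0 -> msderiv (lift ord0 j) (gens i) =
    (j == i)%:R - iota (c i) * (j == i0)%:R.
  move=> ii0; rewrite /gens (negPf ii0) !raddfB /= msderivM dw.
  rewrite !msderiv_series_in_t subr0 mul0r add0r msderivX.
  by rewrite (inj_eq (@lift_inj _ _)).
move=> g Qg.
(* For i different from [i0], d/dx_i kills every generator except the one at i, so that relation is
   [g i] itself. *)
have Qne i : i != i0 -> curve_ideal (branch o) (g i).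
  move=> ii0; have := Qg i; rewrite (bigD1 i) //= dz // eqxx (negPf ii0).
  rewrite mulr0 subr0 mulr1 big1 ?addr0 // => j ji.
  have [->|ji0] := eqVneq j i0.
    by rewrite dz0 (negPf ii0) mulr0 mul0rn mulr0.
  by rewrite dz // (negPf ii0) eq_sym (negPf ji) !mulr0 subr0 mulr0.
(* In the relation for [i0] the other g_j vanish on the curve, which leaves 2 o times the value of g
   at [i0]. *)
move=> i; have [->|] := eqVneq i i0; last exact: Qne.
have /(curve_idealP fo0) := Qg i0; rewrite (bigD1 i0) //= dz0 eqxx mulr1.
rewrite rmorphD rmorph_sum big1 => [|j ji0]; last first.
  by rewrite rmorphM /= (iffLR (curve_idealP fo0 _) (Qne j ji0)) mul0r.
rewrite addr0 rmorphM rmorphMn /= branch_w mulrnAr.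
move=> /(mulr2_eq0 two0)/mseries1_domain[/(curve_idealP fo0)//|].
by move/eqP; rewrite (negPf o0).
Qed.

End Ramified.

(** * Splitting f into even and odd parts, and the final statement *)

Lemma symbolic_square_curve (K : fieldType) (m : nat) (f : 'I_m -> mseries 1 K) :
  (2 : K) != 0 -> (forall i, f i 0%MM = 0) ->
  symbolic_power (curve_contraction f) 2 `<=`
    ideal_mul (@even_max K m) (curve_contraction f).
Proof.
move=> two0 f0; pose h : mseries 1 K := msC 2^-1.
have h2 : h + h = 1.
  by rewrite -rmorphD -mulr2n -(mulr_natl 2^-1) divff // rmorph1.
have negh : neg_arg h = h.
  apply/mseriesP => u; rewrite neg_argE mscoefC; case: eqP => [->|_].
    by rewrite mdeg0 mul1r.
  by rewrite !mulr0.
pose a i := h * (f i + neg_arg (f i)); pose d i := h * (f i - neg_arg (f i)).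
have aE i : neg_arg (a i) = a i.
  by rewrite rmorphM rmorphD /= negh neg_argK addrC.
have dE i : neg_arg (d i) = - d i.
  by rewrite rmorphM rmorphB /= negh neg_argK -mulrN opprB.
have fE i : f i = a i + d i.
  by rewrite -mulrDr addrACA subrr addr0 mulrDr -mulrDl h2 mul1r.
clearbody a d.
have [d0|] := pselect (forall i, d i = 0).
  apply: symbolic_square_even => // i.
  by rewrite fE d0 addr0 aE.
move=> nd; have [|i0 [c [d0 dc]]] := @mseries1_family _ _ d.
  apply: contrapT => nex; apply: nd => i; apply: contrapT => /eqP di.
  by apply: nex; exists i.
have cancel x y : x * d i0 = y * d i0 -> x = y.
  move=> /eqP; rewrite -subr_eq0 -mulrBl => /eqP/mseries1_domain[/eqP|/eqP].
    by rewrite subr_eq0 => /eqP.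
  by rewrite (negPf d0).
(* A quotient of two odd series is even: negate t in d_i = c_i d_(i0) and cancel. *)
have cE i : neg_arg (c i) = c i.
  apply: cancel; have := congr1 (@neg_arg K) (dc i).
  by rewrite rmorphM /= !dE mulrN => /oppr_inj <-.
have ci0 : c i0 = 1 by apply: cancel; rewrite -dc mul1r.
have fb : f = fun i => a i + c i * d i0.
  by apply/funext => i; rewrite -dc fE.
rewrite fb; apply: (symbolic_square_ramified two0 aE cE (dE i0) d0 ci0) => i.
  by rewrite -dc -fE.
(* The branch for - d_(i0) is f_i(-t), whose constant term is that of f_i. *)
rewrite mulrN -dc -dE -aE -rmorphD -fE.
by rewrite [LHS]neg_argE f0 mulr0.
Qed.

(** A nonzero constant term of some f_i would make x_i - f_i a unit and Q1 the whole ring; [f0]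
    excludes this. *)
Theorem theorem2p1 (k : fieldType) (char0 : [pchar k] =i pred0) (m : nat)
    (f : 'I_m -> mseries 1 k) (f0 : forall i, f i 0%MM = 0) :
  let R := mseries m.+1 k in
  let S := even_series k m in
  let Q1 : set R := ideal_gen
    [set var_x k i - series_in_t m (f i) | i in [set: 'I_m]] in
  let Q2 : set R := ideal_gen
    [set var_x k i - series_in_t m (neg_arg (f i)) | i in [set: 'I_m]] in
  let P : set S := [set s | Q1 (even_val s)] in
  let M : set S := ideal_gen
    ([set even_t2 k m] `|` [set even_x k i | i in [set: 'I_m]]) in
  [/\ prime_ideal Q1 /\ prime_ideal Q2,
      @sigma k m @` Q1 = Q2,
      prime_ideal P,
      P = [set s | Q2 (even_val s)] /\
      P = [set s | (Q1 `&` Q2) (even_val s)]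
    & symbolic_power P 2 `<=` ideal_mul M P].
Proof.
have two0 : (2 : k) != 0.
  by have := char0 2%N; rewrite !inE /= => /negbT.
have nf0 i : neg_arg (f i) 0%MM = 0 by rewrite neg_argE f0 mulr0.
move=> R S Q1 Q2 P M.
have PE : P = [set s | Q2 (even_val s)] := curve_contraction_neg two0 f.
split.
- by split; exact: curve_ideal_prime.
- exact: sigma_curve_ideal_image.
- exact: curve_contraction_prime f0.
- split=> //; apply/seteqP; split=> [s Ps|s []//]; split=> //.
  by move: Ps; rewrite PE.
- exact: symbolic_square_curve.
Qed.
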